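(* Let $n\ge 1$ and let $A\in \mathrm{SL}(n,\mathbb{H})$ be a reversible element of $\mathrm{SL}(n,\mathbb{H})$. Then $A$ is strongly reversible in $\mathrm{SL}(n,\mathbb{H})$ if and only if, in the Jordan decomposition of $A$, every Jordan block corresponding to a non-real eigenvalue class of unit modulus has even multiplicity; that is, for every $\alpha\in\mathbb{C}$ with $\mathrm{Im}(\alpha)>0$ and $|\alpha|=1$ and every integer $t\ge 1$, the number of blocks equal to $\mathrm{J}(\alpha,t)$ in the Jordan decomposition of $A$ is even.
   Context: $\mathbb{H}$ denotes the real quaternions. Determinant: for $A\in \mathrm{M}(n,\mathbb{H})$ write $A=A_1+A_2\mathbf{j}$ with $A_1,A_2\in \mathrm{M}(n,\mathbb{C})$, and set $\det(A):=\det\begin{pmatrix} A_1 & A_2\\ -\overline{A_2} & \overline{A_1}\end{pmatrix}$. $\mathrm{SL}(n,\mathbb{H})=\{g\in \mathrm{M}(n,\mathbb{H}) : \det(g)=1\}$. $\mathrm{J}(\lambda,m)$ is the $m\times m$ Jordan block with $\lambda$ on the diagonal, $1$ on the superdiagonal and $0$ elsewhere. Jordan decomposition over $\mathbb{H}$: every $A\in\mathrm{M}(n,\mathbb{H})$ is conjugate by an element of $\mathrm{GL}(n,\mathbb{H})$ to $\mathrm{J}(\lambda_1,m_1)\oplus\cdots\oplus\mathrm{J}(\lambda_k,m_k)$ with $\lambda_1,\dots,\lambda_k\in\mathbb{C}$ (not necessarily distinct) of non-negative imaginary part, and this form is unique up to permutation of the blocks. In a group $G$ with identity $e$: an involution is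 an element $\iota$ with $\iota^2=e$; $g$ is reversible if $hgh^{-1}=g^{-1}$ for some $h\in G$; $g$ is strongly reversible if $hgh^{-1}=g^{-1}$ for some involution $h\in G$ (equivalently, $g$ is a product of two involutions in $G$). *)

(* Defs.v *)
From HB Require Import structures.
From mathcomp Require Import all_boot all_order all_algebra.
From mathcomp Require Import ring.
From mathcomp Require Import complex.

Set Implicit Arguments.
Unset Strict Implicit.
Unset Printing Implicit Defensive.

Import Order.TTheory GRing.Theory Num.Theory.
Local Open Scope ring_scope.

(* [Quaternion a b] stands for a + b j with a, b complex; the product below is
   determined by j ^ 2 = -1 and j z = z^* j. *)
Record quaternion (R : Type) : Type :=
  Quaternion { qfst : R[i]; qsnd : R[i] }.

Definition quaternion_of_complex (R : rcfType) (z : R[i]) : quaternion R :=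
  Quaternion z 0.

Section QuaternionRing.
Variable R : rcfType.
Local Notation H := (quaternion R).
Implicit Types x y z : H.

Definition quat_pair x := (qfst x, qsnd x).
Definition pair_quat (p : R[i] * R[i]) : H := Quaternion p.1 p.2.
Lemma quat_pairK : cancel quat_pair pair_quat. Proof. by case. Qed.

HB.instance Definition _ := Choice.copy H (can_type quat_pairK).

Lemma quat_eq x y : qfst x = qfst y -> qsnd x = qsnd y -> x = y.
Proof. by case: x y => [a b] [c d] /= -> ->. Qed.

Definition addq x y := Quaternion (qfst x + qfst y) (qsnd x + qsnd y).
Definition oppq x := Quaternion (- qfst x) (- qsnd x).
Definition zeroq : H := Quaternion 0 0.
Definition oneq : H := Quaternion 1 0.
Definition mulq x y := Quaternion
  (qfst x * qfst y - qsnd x * conjc (qsnd y))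
  (qfst x * qsnd y + qsnd x * conjc (qfst y)).

Lemma addqA : associative addq.
Proof. by move=> x y z; apply: quat_eq; rewrite /= addrA. Qed.
Lemma addqC : commutative addq.
Proof. by move=> x y; apply: quat_eq; rewrite /= addrC. Qed.
Lemma add0q : left_id zeroq addq.
Proof. by move=> x; apply: quat_eq; rewrite /= add0r. Qed.
Lemma addNq : left_inverse zeroq oppq addq.
Proof. by move=> x; apply: quat_eq; rewrite /= addNr. Qed.

HB.instance Definition _ := GRing.isZmodule.Build H addqA addqC add0q addNq.

Lemma mulqA : associative mulq.
Proof.
by move=> x y z; apply: quat_eq; rewrite /= !(rmorphB, rmorphD, rmorphM) /= ?conjcK; ring.
Qed.
Lemma mul1q : left_id oneq mulq.
Proof. by move=> x; apply: quat_eq; rewrite /= !mul1r !mul0r ?subr0 ?addr0. Qed.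
Lemma mulq1 : right_id oneq mulq.
Proof.
move=> x; apply: quat_eq.
  by rewrite -[LHS]/(qfst x * 1 - qsnd x * conjc 0) rmorph0 mulr1 mulr0 subr0.
by rewrite -[LHS]/(qfst x * 0 + qsnd x * conjc 1) rmorph1 mulr1 mulr0 add0r.
Qed.
Lemma mulqDl : left_distributive mulq addq.
Proof. by move=> x y z; apply: quat_eq; rewrite /=; ring. Qed.
Lemma mulqDr : right_distributive mulq addq.
Proof. by move=> x y z; apply: quat_eq; rewrite /= !rmorphD /=; ring. Qed.
Lemma oneq_neq0 : oneq != zeroq.
Proof. by apply/eqP => /(congr1 (@qfst R)) /= /eqP; rewrite oner_eq0. Qed.

HB.instance Definition _ :=
  GRing.Zmodule_isNzRing.Build H mulqA mul1q mulq1 mulqDl mulqDr oneq_neq0.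

End QuaternionRing.

Section ComplexRepresentation.
Variables (R : rcfType) (n : nat).
Implicit Types A B : 'M[quaternion R]_n.

Definition mxfst A : 'M[R[i]]_n := map_mx (@qfst R) A.
Definition mxsnd A : 'M[R[i]]_n := map_mx (@qsnd R) A.

Definition mxcomplex A : 'M[R[i]]_(n + n) :=
  block_mx (mxfst A) (mxsnd A)
    (- map_mx conjc (mxsnd A)) (map_mx conjc (mxfst A)).

Definition qdet A : R[i] := \det (mxcomplex A).

Definition mxquat (A1 A2 : 'M[R[i]]_n) : 'M[quaternion R]_n :=
  \matrix_(i, j) Quaternion (A1 i j) (A2 i j).

Lemma mxfst_mul A B :
  mxfst (A *m B) = mxfst A *m mxfst B - mxsnd A *m map_mx conjc (mxsnd B).
Proof.
apply/matrixP => i j; rewrite !mxE.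
rewrite (big_morph (@qfst R) (id1 := 0) (op1 := +%R)) //.
rewrite -sumrB; apply: eq_bigr => k _.
by rewrite !mxE.
Qed.

Lemma mxsnd_mul A B :
  mxsnd (A *m B) = mxfst A *m mxsnd B + mxsnd A *m map_mx conjc (mxfst B).
Proof.
apply/matrixP => i j; rewrite !mxE.
rewrite (big_morph (@qsnd R) (id1 := 0) (op1 := +%R)) //.
rewrite -big_split; apply: eq_bigr => k _.
by rewrite !mxE.
Qed.

Lemma map_conjcK p q (M : 'M[R[i]]_(p, q)) : map_mx conjc (map_mx conjc M) = M.
Proof. by apply/matrixP => i j; rewrite !mxE conjcK. Qed.

Lemma mxcomplexM A B : mxcomplex (A *m B) = mxcomplex A *m mxcomplex B.
Proof.
rewrite /mxcomplex mulmx_block mxfst_mul mxsnd_mul.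
rewrite !map_mxD map_mxN !map_mxM /= !map_conjcK.
rewrite !mulmxN !mulNmx opprD.
by rewrite [X in block_mx _ _ X _]addrC [X in block_mx _ _ _ X]addrC.
Qed.

Lemma mxcomplex1 : mxcomplex 1%:M = 1%:M.
Proof.
have e1 : mxfst 1%:M = 1%:M :> 'M_n.
  by apply/matrixP => i j; rewrite !mxE; case: (i == j).
have e2 : mxsnd 1%:M = 0 :> 'M_n.
  by apply/matrixP => i j; rewrite !mxE; case: (i == j).
by rewrite /mxcomplex e1 e2 map_mx0 map_mx1 oppr0 -scalar_mx_block.
Qed.

Lemma mxcomplex_inj : injective mxcomplex.
Proof.
move=> A B /eq_block_mx[/matrixP e1 /matrixP e2 _ _].
by apply/matrixP => i j; apply: quat_eq; [have := e1 i j|have := e2 i j]; rewrite !mxE.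
Qed.

Lemma qdetM A B : qdet (A *m B) = qdet A * qdet B.
Proof. by rewrite /qdet mxcomplexM det_mulmx. Qed.

Lemma qdet1 : qdet 1%:M = 1.
Proof. by rewrite /qdet mxcomplex1 det1. Qed.

Definition mxJ : 'M[R[i]]_(n + n) := block_mx 0 1%:M (- 1%:M) 0.

(* The image of [mxcomplex] is the commutant of the antilinear map v |-> J v^*. *)
Lemma mxcomplex_imP (M : 'M[R[i]]_(n + n)) :
  M *m mxJ = mxJ *m map_mx conjc M ->
  M = mxcomplex (mxquat (ulsubmx M) (ursubmx M)).
Proof.
rewrite -{1 2 3}[M]submxK /mxJ map_block_mx !mulmx_block.
rewrite !mulmxN !mul0mx !mulmx0 !mulmx1 ?mulNmx !mul1mx ?add0r ?addr0.
move=> /eq_block_mx[e1 e2 e3 e4].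
rewrite /mxcomplex.
have -> : mxfst (mxquat (ulsubmx M) (ursubmx M)) = ulsubmx M.
  by apply/matrixP => i j; rewrite !mxE.
have -> : mxsnd (mxquat (ulsubmx M) (ursubmx M)) = ursubmx M.
  by apply/matrixP => i j; rewrite !mxE.
have -> : map_mx conjc (ursubmx M) = - dlsubmx M by rewrite e4 opprK.
by rewrite opprK -(oppr_inj e3) submxK.
Qed.

Lemma mxcomplex_comm A : mxcomplex A *m mxJ = mxJ *m map_mx conjc (mxcomplex A).
Proof.
rewrite /mxJ /mxcomplex map_block_mx !mulmx_block map_mxN !map_conjcK.
by rewrite !mulmxN !mul0mx !mulmx0 !mulmx1 ?mulNmx !mul1mx ?add0r ?addr0 ?opprK ?subr0.
Qed.

Definition mxinvq A : 'M[quaternion R]_n :=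
  let M := invmx (mxcomplex A) in mxquat (ulsubmx M) (ursubmx M).

Lemma mxcomplexV A : qdet A = 1 -> mxcomplex (mxinvq A) = invmx (mxcomplex A).
Proof.
move=> detA; rewrite -mxcomplex_imP //.
have uA : mxcomplex A \in unitmx by rewrite unitmxE -/(qdet A) detA unitr1.
apply: (can_inj (mulKmx uA)); rewrite mulmxA mulmxV // mul1mx.
by rewrite mulmxA mxcomplex_comm -mulmxA -map_mxM /= mulmxV // map_mx1 mulmx1.
Qed.

Lemma mulmxVq A : qdet A = 1 -> A *m mxinvq A = 1%:M.
Proof.
move=> detA; apply: mxcomplex_inj; rewrite mxcomplexM mxcomplexV // mxcomplex1.
by rewrite mulmxV // unitmxE -/(qdet A) detA unitr1.
Qed.

Lemma mulVmxq A : qdet A = 1 -> mxinvq A *m A = 1%:M.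
Proof.
move=> detA; apply: mxcomplex_inj; rewrite mxcomplexM mxcomplexV // mxcomplex1.
by rewrite mulVmx // unitmxE -/(qdet A) detA unitr1.
Qed.

Lemma qdetV A : qdet A = 1 -> qdet (mxinvq A) = 1.
Proof. by move=> detA; rewrite -[LHS]mul1r -detA -qdetM mulmxVq ?qdet1. Qed.

End ComplexRepresentation.

Record SLH (R : rcfType) (n : nat) : Type :=
  MkSLH { slmx :> 'M[quaternion R]_n; slmx_det : qdet slmx == 1 }.

HB.instance Definition _ R n := [isSub for @slmx R n].
HB.instance Definition _ R n := [Choice of SLH R n by <:].

Section SLHGroup.
Variables (R : rcfType) (n : nat).
Implicit Types A B : SLH R n.

Lemma one_SLH_subproof : qdet (1%:M : 'M[quaternion R]_n) == 1.
Proof. by rewrite qdet1. Qed.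
Lemma mul_SLH_subproof A B : qdet (slmx A *m slmx B) == 1.
Proof. by rewrite qdetM (eqP (slmx_det A)) (eqP (slmx_det B)) mulr1. Qed.
Lemma inv_SLH_subproof A : qdet (mxinvq (slmx A)) == 1.
Proof. by rewrite qdetV // (eqP (slmx_det A)). Qed.

Definition one_SLH : SLH R n := MkSLH one_SLH_subproof.
Definition mul_SLH A B : SLH R n := MkSLH (mul_SLH_subproof A B).
Definition inv_SLH A : SLH R n := MkSLH (inv_SLH_subproof A).

Lemma mul_SLHA : associative mul_SLH.
Proof. by move=> A B C; apply: val_inj; rewrite /= mulmxA. Qed.
Lemma mul1_SLH : left_id one_SLH mul_SLH.
Proof. by move=> A; apply: val_inj; rewrite /= mul1mx. Qed.
Lemma mul_SLH1 : right_id one_SLH mul_SLH.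
Proof. by move=> A; apply: val_inj; rewrite /= mulmx1. Qed.
Lemma mulV_SLH : left_inverse one_SLH inv_SLH mul_SLH.
Proof. by move=> A; apply: val_inj; rewrite /= mulVmxq // (eqP (slmx_det A)). Qed.
Lemma mul_SLHV : right_inverse one_SLH inv_SLH mul_SLH.
Proof. by move=> A; apply: val_inj; rewrite /= mulmxVq // (eqP (slmx_det A)). Qed.

HB.instance Definition _ :=
  isGroup.Build (SLH R n) mul_SLHA mul1_SLH mul_SLH1 mulV_SLH mul_SLHV.

End SLHGroup.

Section Reversibility.
Variable G : groupType.
Local Open Scope group_scope.

Definition involution (h : G) : Prop := h ^+ 2 = 1.

Definition reversible (g : G) : Prop := exists h : G, h * g * h^-1 = g^-1.

Definition strongly_reversible (g : G) : Prop :=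
  exists h : G, involution h /\ h * g * h^-1 = g^-1.

End Reversibility.

Definition jordan_block (R : rcfType) (lam : R[i]) (m : nat) :
    'M[quaternion R]_m :=
  \matrix_(i < m, j < m)
    if j == i then quaternion_of_complex lam
    else if j == i.+1 :> nat then 1 else 0.

(* The existential proof [e] only transports the direct sum of the blocks, a
   square matrix of size [\sum_i m i], to size [n]. *)
Definition jordan_decomposition (R : rcfType) (n : nat)
    (A : 'M[quaternion R]_n) (k : nat)
    (lam : 'I_k -> R[i]) (m : 'I_k -> nat) : Prop :=
  [/\ forall i, 0 <= complex.Im (lam i),
      forall i, (0 < m i)%N
    & exists (e : (\sum_i m i)%N = n) (S T : 'M[quaternion R]_n),
        [/\ S *m T = 1%:M, T *m S = 1%:M
          & S *m A *m T
            = castmx (e, e) (\mxdiag_(i < k) jordan_block (lam i) (m i))]].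

(* Main.v *)
From HB Require Import structures.
Require Import Defs.
From mathcomp Require Import all_boot all_order all_algebra.
From mathcomp Require Import reals.
From mathcomp Require Import complex.
From mathcomp Require Import zify ring.

Import Order.TTheory GRing.Theory Num.Theory.
Local Open Scope ring_scope.

(* Write X for the complex 2n x 2n matrix of A and J for the quaternionic
   structure it commutes with. If h is an involution reversing A and
   |a| = 1, then J composed with h is an antilinear map of square -1 preserving
   each ker (X - a)^l, since a^-1 is the conjugate of a. Such a kernel thus has even
   dimension (|det Q|^2 = (-1)^r for the matrix Q of the map in a basis), and the
   number of blocks J(a, t) is a second difference of these dimensions.

   Conversely, as X is similar to its inverse, the ranks of (X - a)^l show that
   J(a, t) and J(conj(a)^-1, t) have the same multiplicity. So the blocks can be
   matched by an involution p, fixing only blocks with real eigenvalue, and h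
   is built blockwise from Y * s, where Y conjugates J(a^-1, t) to J(a, t)^-1 and
   s is 1 for real a, and j or -j otherwise, with opposite signs at i and p i. *)

(** * Powers of Jordan blocks *)

Section Jordan.
Variable F : fieldType.

Definition shiftmx (m : nat) : 'M[F]_m := \matrix_(i, j) (j == i.+1 :> nat)%:R.
Definition jordan (a : F) (m : nat) : 'M[F]_m := a%:M + shiftmx m.

Lemma shiftmx_exp (m k : nat) :
  shiftmx m ^+ k = \matrix_(i, j) (j == (i + k)%N :> nat)%:R.
Proof.
elim: k => [|k IH].
  by apply/matrixP => i j; rewrite !mxE addn0 -val_eqE eq_sym.
apply/matrixP => i j; rewrite exprS IH !mxE.
under eq_bigr do rewrite !mxE -natrM mulnb.
case: (ltnP i.+1 m) => hi.
  rewrite (bigD1 (Ordinal hi)) //= eqxx /= big1 ?addr0 ?addSnnS // => l.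
  by rewrite -val_eqE /= => /negPf->.
rewrite big1; last first.
  by move=> l _; rewrite (_ : l == i.+1 :> nat = false) //; have := ltn_ord l; lia.
by rewrite (_ : j == (i + k.+1)%N :> nat = false)//; have := ltn_ord j; lia.
Qed.

Lemma shiftmx_nilp (m : nat) : shiftmx m ^+ m = 0.
Proof.
rewrite shiftmx_exp; apply/matrixP => i j; rewrite !mxE.
by rewrite (_ : j == (i + m)%N :> nat = false)//; have := ltn_ord j; lia.
Qed.

(** With N = [shiftmx m ^+ k], the product N N^T is the projection onto the first m - k coordinates,
    and that projection fixes N from the left. These bound the rank from both sides. *)
Lemma rank_shiftmx_exp (m k : nat) : \rank (shiftmx m ^+ k) = (m - k)%N.
Proof.
rewrite shiftmx_exp; set N := (X in \rank X).
have rp : \rank (pid_mx (m - k) : 'M[F]_m) = (m - k)%N.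
  by rewrite rank_pid_mx ?leq_subr.
have NNT : N *m N^T = pid_mx (m - k).
  apply/matrixP => i j; rewrite !mxE.
  under eq_bigr do rewrite !mxE -natrM mulnb.
  case: (ltnP (i + k)%N m) => hi.
    rewrite (bigD1 (Ordinal hi)) //= eqxx /= big1 ?addr0.
      by congr (_%:R); rewrite eqn_add2r; lia.
    by move=> l; rewrite -val_eqE /= => /negPf->.
  rewrite big1 => [|l _].
    by rewrite (_ : (i < m - k)%N = false) ?andbF //; lia.
  by rewrite (_ : l == (i + k)%N :> nat = false) //; have := ltn_ord l; lia.
have pN : N = pid_mx (m - k) *m N.
  apply/matrixP => i j; rewrite !mxE (bigD1 i) //= big1 => [|l].
    rewrite !mxE eqxx /= addr0 -natrM mulnb; congr (_%:R).
    by have := ltn_ord j; lia.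
  by rewrite -val_eqE mxE /= eq_sym => /negPf->; rewrite mul0r.
apply/eqP; rewrite eqn_leq; apply/andP; split.
  by rewrite -[leqRHS]rp pN mxrankM_maxl.
by rewrite -[leqLHS]rp -NNT mxrankM_maxl.
Qed.

Lemma expmx_unit (m k : nat) (A : 'M[F]_m) : A \in unitmx -> A ^+ k \in unitmx.
Proof.
move=> uA; elim: k => [|k IH]; first exact: unitmx1.
by rewrite exprS -mulmxE unitmx_mul uA.
Qed.

Lemma unitmx_jordan (a : F) (m : nat) : a != 0 -> jordan a m \in unitmx.
Proof.
move=> a0; rewrite unitmxE -det_tr det_trig.
  rewrite unitfE; apply/prodf_neq0 => i _.
  by rewrite !mxE eqxx (_ : i == i.+1 :> nat = false) ?addr0 //; lia.
apply/is_trig_mxP => i j ij; rewrite !mxE -val_eqE /=.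
by rewrite (gtn_eqF ij) (ltn_eqF (leqW ij)) addr0.
Qed.

Lemma rank_jordan_exp (a b : F) (m k : nat) :
  \rank ((jordan a m - b%:M) ^+ k) = if a == b then (m - k)%N else m.
Proof.
have -> : jordan a m - b%:M = jordan (a - b) m by rewrite /jordan raddfB /= addrAC.
case: eqVneq => [->|ab]; first by rewrite subrr /jordan raddf0 add0r rank_shiftmx_exp.
by apply/mxrank_unit/expmx_unit/unitmx_jordan; rewrite subr_eq0.
Qed.

End Jordan.

(** * Conjugating a Jordan block to the inverse of another *)

Section Flip.
Variable F : fieldType.

(** With [jordan a m] acting as x, this is the image of x - a^-1 under x |-> x^-1. *)
Definition flip_gen (a : F) (m : nat) : 'M[F]_m :=
  invmx (jordan F a m) - (a^-1)%:M.

(* The substitution x |-> x^-1 from F[x]/(x - a^-1)^m to F[x]/(x - a)^m, in the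
   bases of powers of x - a^-1 and x - a. *)
Definition flipmx (a : F) (m : nat) : 'M[F]_m :=
  if m is n.+1 then \matrix_(i < n.+1) row 0 (flip_gen a n.+1 ^+ i) else 0.

(** For J = a + N one has J^-1 - a^-1 = -a^-1 J^-1 N with commuting factors, so the nilpotency of N
    carries over. *)
Lemma flip_gen_nilp (a : F) (m : nat) : a != 0 -> flip_gen a m ^+ m = 0.
Proof.
move=> a0; have uJ := unitmx_jordan F a m a0.
have cJ : GRing.comm (jordan F a m) (shiftmx F m).
  by rewrite /GRing.comm /jordan mulrDl mulrDr -!mulmxE scalar_mxC.
have -> : flip_gen a m = (- a^-1)%:M * (invmx (jordan F a m) * shiftmx F m).
  apply: (can_inj (mulKmx uJ)); rewrite -!mulmxE !mulmxA scalar_mxC.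
  rewrite -(mulmxA _%:M) mulmxV // mulmx1 mulmxBr mulmxV // scalar_mxC.
  by rewrite /jordan mulmxDr -scalar_mxM mulVf // opprD addNKr raddfN mulNmx.
have cV : GRing.comm (invmx (jordan F a m)) (shiftmx F m).
  apply: (can_inj (mulKmx uJ)); rewrite -!mulmxE mulKVmx // mulmxA.
  by rewrite [jordan F a m *m _]cJ -mulmxA mulmxV ?mulmx1.
rewrite exprMn_comm; last by rewrite /GRing.comm -!mulmxE scalar_mxC.
by rewrite (exprMn_comm _ cV) shiftmx_nilp !mulr0.
Qed.

(** Row i of [flipmx a m] is e_0 g^i with g = J^-1 - a^-1 and J = [jordan a m]. The left factor
    turns it into e_0 g^i (a^-1 + g) = e_0 g^i J^-1, which the right factor J undoes. *)
Lemma jordan_flip (a : F) (m : nat) : a != 0 ->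
  jordan F a^-1 m *m flipmx a m *m jordan F a m = flipmx a m.
Proof.
case: m => [|n] a0; first by rewrite flatmx0 [RHS]flatmx0.
have uJ := unitmx_jordan F a n.+1 a0.
apply: (can_inj (mulmxK (_ : invmx (jordan F a n.+1) \in unitmx))).
  by rewrite unitmx_inv.
rewrite mulmxK //; apply/row_matrixP => i.
rewrite /jordan mulmxDl linearD /= mul_scalar_mx linearZ /=.
have rowS : row i (shiftmx F n.+1 *m flipmx a n.+1) = row 0 (flip_gen a n.+1 ^+ i.+1).
  rewrite row_mul; case: (ltnP i.+1 n.+1) => hi.
    have -> : row i (shiftmx F n.+1) = delta_mx 0 (Ordinal hi).
      by apply/rowP => j; rewrite !mxE eqxx.
    by rewrite -rowE rowK.
  (* The last row has no successor: the shift contributes 0, in agreement with g^(n+1) = 0. *)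
  have -> : row i (shiftmx F n.+1) = 0.
    by apply/rowP => j; rewrite !mxE ltn_eqF //; apply: leq_trans hi.
  have -> : i.+1 = n.+1 by apply/eqP; rewrite eqn_leq hi ltn_ord.
  by rewrite flip_gen_nilp // mul0mx linear0.
rewrite rowS row_mul -/(jordan F a n.+1) !rowK exprSr -mulmxE row_mul.
by rewrite /flip_gen mulmxBr scalar_mxC mul_scalar_mx addrC subrK.
Qed.

(** By [jordan_flip], the generator g' for a^-1 satisfies g' Y = Y N, where Y = [flipmx a m] and N
    is the shift. Row i of the product is then e_0 g'^i Y = e_0 Y N^i = e_0 N^i = e_i. *)
Lemma flipmxV (a : F) (m : nat) : a != 0 -> flipmx a^-1 m *m flipmx a m = 1%:M.
Proof.
case: m => [|n] a0; first by rewrite flatmx0 [RHS]flatmx0.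
have uJ := unitmx_jordan F a n.+1 a0.
have uJV : jordan F a^-1 n.+1 \in unitmx by rewrite unitmx_jordan // invr_eq0.
have genY : flip_gen a^-1 n.+1 *m flipmx a n.+1 = flipmx a n.+1 *m shiftmx F n.+1.
  have h : invmx (jordan F a^-1 n.+1) *m flipmx a n.+1 = flipmx a n.+1 *m jordan F a n.+1.
    by apply: (can_inj (mulKmx uJV)); rewrite mulKVmx // mulmxA jordan_flip.
  by rewrite /flip_gen invrK mulmxBl h /jordan mulmxDr scalar_mxC addrAC subrr add0r.
have expY k : flip_gen a^-1 n.+1 ^+ k *m flipmx a n.+1
    = flipmx a n.+1 *m shiftmx F n.+1 ^+ k.
  elim: k => [|k IH]; first by rewrite !expr0 mul1mx mulmx1.
  by rewrite !exprSr -!mulmxE -mulmxA genY mulmxA IH mulmxA.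
apply/row_matrixP => i; rewrite row_mul rowK -row_mul expY row_mul rowK expr0.
rewrite -row_mul mul1mx shiftmx_exp; apply/rowP => j; rewrite !mxE add0n.
by rewrite eq_sym.
Qed.

End Flip.

Lemma map_shiftmx (F K : fieldType) (f : {rmorphism F -> K}) (m : nat) :
  map_mx f (shiftmx F m) = shiftmx K m.
Proof. by apply/matrixP => i j; rewrite !mxE rmorph_nat. Qed.

Lemma map_jordan (F K : fieldType) (f : {rmorphism F -> K}) (a : F) (m : nat) :
  map_mx f (jordan F a m) = jordan K (f a) m.
Proof. by rewrite /jordan map_mxD map_scalar_mx map_shiftmx. Qed.

Lemma map_flipmx (F K : fieldType) (f : {rmorphism F -> K}) (a : F) (m : nat) :
  map_mx f (flipmx F a m) = flipmx K (f a) m.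
Proof.
case: m => [|n]; first by rewrite [LHS]flatmx0 [RHS]flatmx0.
apply/row_matrixP => i; rewrite -map_row !rowK map_row rmorphXn /=.
by rewrite map_mxB map_invmx map_jordan map_scalar_mx fmorphV.
Qed.

(** * Quaternionic structures *)

Section Even.
Variable R : rcfType.

(** The antilinear map v |-> conj(v) P has square -1 and preserves the row space of K. Its matrix Q
    in a basis B satisfies conj(Q) Q = -1; determinants give (-1)^r >= 0 for the rank r. *)
Lemma even_rank_antilinear (N p : nat) (P : 'M[R[i]]_N) (K : 'M[R[i]]_(p, N)) :
  map_mx conjc P *m P = - 1%:M -> (map_mx conjc K *m P <= K)%MS ->
  ~~ odd (\rank K).
Proof.
move=> PP KP.
set B := row_base K.
have : (map_mx conjc B *m P <= B)%MS.
  rewrite eq_row_base; apply: submx_trans KP; apply: submxMr.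
  by rewrite map_submx eq_row_base.
case/submxP => Q hQ.
have [B' BK] : exists B', B *m B' = 1%:M.
  by exists (pinvmx B); rewrite mulmxVp ?row_base_free.
move: B B' hQ BK => B B' hQ BK.
have QQ : map_mx conjc Q *m Q = - 1%:M.
  rewrite -[LHS]mulmx1 -{1}BK !mulmxA -(mulmxA _ Q) -hQ mulmxA -map_mxM -hQ.
  by rewrite map_mxM map_conjcK -mulmxA PP mulmxN mulmx1 mulNmx BK.
have /(congr1 determinant) := QQ.
rewrite det_mulmx det_map_mx -scaleN1r detZ det1 mulr1 mulrC => e.
have := mulcJ_ge0 (\det Q); rewrite e -signr_odd.
by case: odd => //=; rewrite expr1 oppr_ge0 ler10.
Qed.

(** Sylvester's identity, from two triangular factorisations of one block matrix. *)
Lemma det_one_sub_mulC (F : comNzRingType) (N r : nat) (C : 'M[F]_(N, r)) (D : 'M[F]_(r, N)) :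
  \det (1%:M - C *m D) = \det (1%:M - D *m C).
Proof.
have e1 : block_mx 1%:M C D 1%:M
    = block_mx 1%:M 0 D 1%:M *m block_mx 1%:M C 0 (1%:M - D *m C).
  by rewrite mulmx_block !(mul1mx, mul0mx, mulmx1, mulmx0, addr0) addrC subrK.
have e2 : block_mx 1%:M C D 1%:M
    = block_mx (1%:M - C *m D) C 0 1%:M *m block_mx 1%:M 0 D 1%:M.
  by rewrite mulmx_block !(mul1mx, mul0mx, mulmx1, mulmx0, add0r) subrK.
have := congr1 determinant (etrans (esym e1) e2).
by rewrite !det_mulmx !det_ublock !det_lblock !det1 !mul1r !mulr1.
Qed.

Lemma mxJ_sqr (n : nat) : mxJ R n *m mxJ R n = - 1%:M.
Proof.
rewrite /mxJ mulmx_block !mulmxN !mulNmx !mul0mx !mulmx0 !mulmx1 !addr0 !add0r.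
by rewrite [in RHS]scalar_mx_block opp_block_mx oppr0 addr0.
Qed.

Lemma map_mxJ (n : nat) : map_mx conjc (mxJ R n) = mxJ R n.
Proof. by rewrite /mxJ map_block_mx map_mxN !map_mx0 map_mx1. Qed.

(* The [-1]-eigenspace of [h] is a quaternionic space, hence of even complex dimension. *)
Lemma qdet_involution (n : nat) (h : 'M[quaternion R]_n) :
  h *m h = 1%:M -> qdet h = 1.
Proof.
move=> hh; set H := mxcomplex h.
have HH : H *m H = 1%:M by rewrite -mxcomplexM hh mxcomplex1.
pose c : R[i] := 2%:R^-1.
have cc : conjc c = c by rewrite conjc_inv conjc_nat.
(* The projector onto the -1-eigenspace of H. *)
pose e := c *: (1%:M - H).
have e2 : 2%:R *: e = 1%:M - H by rewrite scalerA mulfV ?scale1r // pnatr_eq0.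
have ee : e *m e = e.
  have sq : (1%:M - H) *m (1%:M - H) = 2%:R *: (1%:M - H).
    by rewrite mulmxBl !mulmxBr !mul1mx mulmx1 HH opprB scaler_nat mulr2n.
  by rewrite -scalemxAl -scalemxAr sq !scalerA -mulrA mulVf ?mulr1 // pnatr_eq0.
have eJ : e *m mxJ R n = mxJ R n *m map_mx conjc e.
  have -> : map_mx conjc e = c *: (1%:M - map_mx conjc H).
    by apply/matrixP => i j; rewrite !mxE rmorphM rmorphB rmorph_nat -{2}cc.
  rewrite /e -scalemxAl -scalemxAr.
  by rewrite mulmxBl mulmxBr mxcomplex_comm mul1mx mulmx1.
have Je : map_mx conjc e *m mxJ R n = mxJ R n *m e.
  by rewrite -[e in RHS]map_conjcK -[in RHS]map_mxJ -map_mxM -eJ map_mxM map_mxJ.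
have er : ~~ odd (\rank e).
  apply: (@even_rank_antilinear _ _ (mxJ R n)); first by rewrite map_mxJ mxJ_sqr.
  by rewrite Je submxMl.
(* H = 1 - 2e with e = [col_base e *m row_base e]; exchanging the two factors leaves the determinant
   of -1 in size rank e. *)
have -> : qdet h = \det (1%:M - (2%:R *: col_base e) *m row_base e).
  by rewrite -scalemxAl mulmx_base e2 opprB addrC subrK.
have DC : row_base e *m col_base e = 1%:M.
  apply: (row_full_inj (col_base_full e)).
  apply: (row_free_inj (row_base_free e)).
  by rewrite mulmx1 mulmxA mulmx_base -mulmxA mulmx_base ee.
rewrite det_one_sub_mulC -scalemxAr DC -[1%:M in X in X - _]scale1r -scalerBl.
rewrite detZ det1 mulr1 (_ : 1 - 2%:R = -1); last by ring.
by rewrite -signr_odd (negPf er).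
Qed.

End Even.

(** * Matching the blocks *)

(** Here f gives the type of a block, [kappa] the type its partner must have, and [fixable] the
    types allowed to be their own partner. The induction on the size of S removes either one point
    of fixable type or a pair of distinct points, and both counting hypotheses survive. *)
Lemma pairing_involution (I : finType) (K : eqType) (f : I -> K) (kappa : K -> K)
    (fixable : pred K) (S : {set I}) :
  involutive kappa -> (forall x, fixable x -> kappa x = x) ->
  (forall x, #|[set i in S | f i == kappa x]| = #|[set i in S | f i == x]|) ->
  (forall x, kappa x = x -> ~~ fixable x -> ~~ odd #|[set i in S | f i == x]|) ->
  exists p : I -> I, {in S, forall i,
    [/\ p i \in S, p (p i) = i, f (p i) = kappa (f i) & p i = i -> fixable (f i)]}.
Proof.
move=> kk fixk; have [n] := ubnP #|S|; elim: n => // n IH in S *.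
rewrite ltnS => cS eqS evS.
have [->|[i iS]] := set_0Vmem S; first by exists id => i; rewrite inE.
have remove (T : {set I}) x : [set j in S :\: T | f j == x] = [set j in S | f j == x] :\: T.
  by apply/setP => j; rewrite !inE -andbA.
case: (boolP (fixable (f i))) => [fi|nfi].
- have ki := fixk _ fi.
  have card_rem x : #|[set j in S :\ i | f j == x]| = (#|[set j in S | f j == x]| - (f i == x))%N.
    by rewrite remove (cardsD1 i [set j in S | _]) !inE iS /= addKn.
  have [||| p hp] := IH (S :\ i).
  + by rewrite (cardsD1 i S) iS in cS.
  + move=> x; rewrite !card_rem eqS.
    by congr (_ - _)%N; rewrite -{1}ki (inj_eq (can_inj kk)).
  + move=> x kx nx; rewrite card_rem.
    have /negPf-> : f i != x by apply: contraNneq nx => <-.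
    by rewrite subn0 evS.
  exists (fun j => if j == i then i else p j) => j jS.
  case: eqVneq => [->|ji]; first by rewrite eqxx.
  have [] := hp j; rewrite ?inE ?ji // => /andP[pji pjS] ppj fpj pj.
  by rewrite (negPf pji).
(* If [kappa] fixes the type of i, evenness provides a second point of that type; otherwise the
   equality of counts provides a point of the partner type. *)
- have [j [jS ji fj]] : exists j, [/\ j \in S, j != i & f j = kappa (f i)].
    have iF : i \in [set j in S | f j == f i] by rewrite inE iS eqxx.
    have [ki|ki] := eqVneq (kappa (f i)) (f i).
      have := evS _ ki nfi; rewrite (cardsD1 i) iF /= negbK => o.
      have [e0|[j]] := set_0Vmem ([set j in S | f j == f i] :\ i).
        by rewrite e0 cards0 in o.
      by rewrite !inE => /and3P[ji jS /eqP fj]; exists j; rewrite ki.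
    have [e0|[j]] := set_0Vmem [set j in S | f j == kappa (f i)].
      by move: (eqS (f i)); rewrite e0 cards0 (cardsD1 i) iF.
    rewrite !inE => /andP[jS /eqP fj]; exists j; split=> //.
    by apply: contraNneq ki => e; rewrite -fj e.
  pose T := [set i; j].
  have fi : kappa (f j) = f i by rewrite fj kk.
  have card2 x : #|[set l in S | f l == x]|
      = ((f i == x) + (f j == x) + #|[set l in S | f l == x] :\ i :\ j|)%N.
    by rewrite (cardsD1 i) (cardsD1 j (_ :\ _)) !inE iS jS ji /= addnA.
  have card_rem x : #|[set l in S :\: T | f l == x]|
      = (#|[set l in S | f l == x]| - ((f i == x) + (f j == x)))%N.
    by rewrite remove /T -setDDl [in RHS]card2 addKn.
  have [||| p hp] := IH (S :\: T).
  + apply: leq_trans cS; apply: proper_card; apply/properP; split; first exact: subsetDl.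
    by exists i; rewrite // !inE eqxx.
  + move=> x; rewrite !card_rem eqS.
    have -> : (f i == kappa x) = (f j == x) by rewrite -fi (inj_eq (can_inj kk)).
    by rewrite fj (inj_eq (can_inj kk)) addnC.
  + move=> x kx nx; rewrite card_rem.
    (* A type fixed by [kappa] loses both i and j or neither, so parity is preserved. *)
    have fjx : (f j == x) = (f i == x) by rewrite -{1}kx fj (inj_eq (can_inj kk)).
    by move: (evS x kx nx); rewrite card2 addKn fjx addnn oddD odd_double.
  exists (fun l => if l == i then j else if l == j then i else p l) => l lS.
  have [->|li] := eqVneq l i.
    by rewrite (negPf ji) eqxx fj jS; split=> // /eqP; rewrite (negPf ji).
  have [->|lj] := eqVneq l j.
    by rewrite eqxx fi iS; split=> // /esym/eqP; rewrite (negPf ji).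
  have [] := hp l; first by rewrite !inE negb_or li lj lS.
  rewrite !inE negb_or => /andP[/andP[pli plj] plS] ppl fpl pl.
  by rewrite (negPf pli) (negPf plj).
Qed.

(** * Counting Jordan blocks by ranks *)

Lemma mxdiag_exp (K : pzSemiRingType) (p : nat) (p_ : 'I_p -> nat)
    (B : forall i, 'M[K]_(p_ i)) (k : nat) :
  (\mxdiag_i B i) ^+ k = \mxdiag_i (B i ^+ k).
Proof.
elim: k => [|k IH]; first exact: (esym (mxdiagZ 1)).
rewrite exprS IH -mulmxE /mxdiag mul_mxdiag_mxblock; apply/eq_mxblock => i j.
by case: eqVneq => [<-|_]; rewrite ?conform_mx_id ?mulmx0 // exprS mulmxE.
Qed.

Lemma map_mxdiag (V W : nmodType) (f : {additive V -> W}) (p : nat) (p_ : 'I_p -> nat)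
    (B : forall i, 'M[V]_(p_ i)) :
  map_mx f (\mxdiag_i B i) = \mxdiag_i map_mx f (B i).
Proof.
rewrite /mxdiag; apply/mxblockP => i j; rewrite {1}/submxblock -map_mxsub.
rewrite -/(submxblock _ i j) !mxblockK.
by case: eqVneq => [<-|_]; rewrite ?conform_mx_id ?map_mx0.
Qed.

Lemma conj_expmx (K : pzSemiRingType) (n : nat) (P Q X : 'M[K]_n) (k : nat) :
  P *m Q = 1%:M -> Q *m P = 1%:M -> P *m X ^+ k *m Q = (P *m X *m Q) ^+ k.
Proof.
move=> PQ QP; elim: k => [|k IH]; first by rewrite !expr0 mulmx1.
by rewrite !exprS -IH -!mulmxE !mulmxA -(mulmxA _ Q P) QP mulmx1.
Qed.

Lemma rank_conj_expmx (F : fieldType) (n : nat) (P Q X : 'M[F]_n) (a : F) (k : nat) :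
  P *m Q = 1%:M -> \rank ((P *m X *m Q - a%:M) ^+ k) = \rank ((X - a%:M) ^+ k).
Proof.
move=> PQ; have QP := mulmx1C PQ.
have -> : P *m X *m Q - a%:M = P *m (X - a%:M) *m Q.
  by rewrite mulmxBr mulmxBl scalar_mxC -(mulmxA _%:M) PQ mulmx1.
rewrite -conj_expmx // mxrankMfree ?row_free_unit.
  by rewrite eqmxMfull // row_full_unit; case/mulmx1_unit: PQ.
by case/mulmx1_unit: PQ.
Qed.

Lemma diag_block_exp (K : pzSemiRingType) (n1 n2 : nat) (A : 'M[K]_n1) (B : 'M[K]_n2) (k : nat) :
  (block_mx A 0 0 B) ^+ k = block_mx (A ^+ k) 0 0 (B ^+ k).
Proof.
elim: k => [|k IH]; first by rewrite !expr0; exact: (scalar_mx_block n1 n2 1).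
by rewrite !exprS IH -!mulmxE mulmx_block !mulmx0 !mul0mx !add0r !addr0.
Qed.

Lemma rank_mxdiag_jordan_exp (F : fieldType) (k : nat) (mu : 'I_k -> F)
    (m : 'I_k -> nat) (a : F) (l : nat) :
  \rank ((\mxdiag_i jordan F (mu i) (m i) - a%:M) ^+ l)
  = (\sum_i (if mu i == a then m i - l else m i))%N.
Proof.
have -> : \mxdiag_i jordan F (mu i) (m i) - a%:M
    = \mxdiag_i (jordan F (mu i) (m i) - a%:M) by rewrite mxdiagB mxdiagZ.
by rewrite mxdiag_exp rank_mxdiag; apply: eq_bigr => i _; rewrite rank_jordan_exp.
Qed.

Section JordanRank.
Variable R : rcfType.
Local Notation C := R[i].

Lemma quaternion_of_complex_is_additive : zmod_morphism (@quaternion_of_complex R).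
Proof. by move=> x y; apply: quat_eq; rewrite //= subr0. Qed.

HB.instance Definition _ :=
  GRing.isZmodMorphism.Build C (quaternion R) (@quaternion_of_complex R)
    quaternion_of_complex_is_additive.

Lemma quaternion_of_complex_is_multiplicative : monoid_morphism (@quaternion_of_complex R).
Proof.
split=> // x y; apply: quat_eq; rewrite /= mul0r ?subr0 //.
by rewrite mulr0 addr0.
Qed.

HB.instance Definition _ :=
  GRing.isMonoidMorphism.Build C (quaternion R) (@quaternion_of_complex R)
    quaternion_of_complex_is_multiplicative.

Lemma jordan_blockE (a : C) (m : nat) :
  jordan_block a m = map_mx (@quaternion_of_complex R) (jordan C a m).
Proof.
apply/matrixP => i j; rewrite !mxE (eq_sym i j).
case: eqVneq => [->|_]; first by rewrite ltn_eqF ?addr0.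
by rewrite add0r; case: eqP => _; rewrite ?rmorph1 ?rmorph0.
Qed.

Lemma mxcomplex_map (n : nat) (D : 'M[C]_n) :
  mxcomplex (map_mx (@quaternion_of_complex R) D) = block_mx D 0 0 (map_mx conjc D).
Proof.
rewrite /mxcomplex; have -> : mxfst (map_mx (@quaternion_of_complex R) D) = D.
  by apply/matrixP => i j; rewrite !mxE.
have -> : mxsnd (map_mx (@quaternion_of_complex R) D) = 0.
  by apply/matrixP => i j; rewrite !mxE.
by rewrite map_mx0 oppr0.
Qed.

(** Over the complex numbers a quaternionic block J(lam, m) becomes J(lam, m) + J(conj(lam), m) as a
    direct sum, whence two terms per block. *)
Lemma rank_jordan_decomposition (n : nat) (A : 'M[quaternion R]_n) (k : nat)
    (lam : 'I_k -> C) (m : 'I_k -> nat) (a : C) (l : nat) :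
  jordan_decomposition A lam m ->
  \rank ((mxcomplex A - a%:M) ^+ l)
  = (\sum_i ((if lam i == a then m i - l else m i) +
             (if (lam i)^*%C == a then m i - l else m i)))%N.
Proof.
case=> _ _ [e [S [T [ST TS]]]]; case: n / e in A S T ST TS *; rewrite castmx_id => SAT.
have ST' : mxcomplex S *m mxcomplex T = 1%:M by rewrite -mxcomplexM ST mxcomplex1.
rewrite -(rank_conj_expmx _ _ _ _ (mxcomplex A) a l ST') -!mxcomplexM SAT.
have -> : \mxdiag_i jordan_block (lam i) (m i)
    = map_mx (@quaternion_of_complex R) (\mxdiag_i jordan C (lam i) (m i)).
  by rewrite map_mxdiag; apply/eq_mxdiag => i; rewrite jordan_blockE.
rewrite mxcomplex_map scalar_mx_block opp_block_mx add_block_mx !oppr0 !addr0.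
rewrite diag_block_exp rank_diag_block_mx big_split /= map_mxdiag.
have -> : \mxdiag_i map_mx conjc (jordan C (lam i) (m i)) = \mxdiag_i jordan C (lam i)^*%C (m i).
  by apply: eq_mxdiag => i; rewrite map_jordan.
by rewrite !rank_mxdiag_jordan_exp.
Qed.

Definition count_blocks (k : nat) (lam : 'I_k -> C) (m : 'I_k -> nat) (a : C) (t : nat) :=
  #|[set i | (lam i == a) && (m i == t)]|.

(** The second difference of l |-> max(m - l, 0) is 1 when the middle point is m and 0 elsewhere. It
    is written additively because subtraction on [nat] truncates; for real a the same blocks are
    counted twice. *)
Lemma rank_diff2_jordan (n : nat) (A : 'M[quaternion R]_n) (k : nat)
    (lam : 'I_k -> C) (m : 'I_k -> nat) (a : C) (t : nat) :
  jordan_decomposition A lam m ->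
  (\rank ((mxcomplex A - a%:M) ^+ t) + \rank ((mxcomplex A - a%:M) ^+ t.+2)
   = (\rank ((mxcomplex A - a%:M) ^+ t.+1)).*2
     + (count_blocks k lam m a t.+1 + count_blocks k lam m a^*%C t.+1))%N.
Proof.
move=> hJ; rewrite !(rank_jordan_decomposition _ _ _ lam m) //.
have cE b : count_blocks k lam m b t.+1 = (\sum_i ((lam i == b) && (m i == t.+1)))%N.
  rewrite /count_blocks cardsE -sum1_card big_mkcond.
  by apply: eq_bigr => i _; rewrite unfold_in; case: ifP.
rewrite !cE -addnn -!big_split /=; apply: eq_bigr => i _.
have -> : ((lam i)^*%C == a) = (lam i == a^*%C).
  by rewrite -[in RHS](inj_eq (can_inj (@conjcK R))) conjcK.
by do 2 case: eqP => _ /=; lia.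
Qed.

Lemma count_blocks_eq (n : nat) (A : 'M[quaternion R]_n) (k : nat)
    (lam : 'I_k -> C) (m : 'I_k -> nat) (a b : C) (t : nat) :
  jordan_decomposition A lam m ->
  (forall l, \rank ((mxcomplex A - a%:M) ^+ l) = \rank ((mxcomplex A - b%:M) ^+ l)) ->
  (count_blocks k lam m a t.+1 + count_blocks k lam m a^*%C t.+1
   = count_blocks k lam m b t.+1 + count_blocks k lam m b^*%C t.+1)%N.
Proof.
move=> hJ rank_eq.
have ea := rank_diff2_jordan _ _ _ _ _ a t hJ.
have eb := rank_diff2_jordan _ _ _ _ _ b t hJ.
(* Rewriting with [rank_eq] would make unification unfold [mxrank]. *)
have e := etrans (esym ea) (etrans (congr2 addn (rank_eq t) (rank_eq t.+2)) eb).
exact: addnI (etrans e (congr1 (fun r => r.*2 + _)%N (esym (rank_eq t.+1)))).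
Qed.

End JordanRank.

(** * The reversing involution of a matched Jordan form *)

Section Involution.
Variable R : rcfType.
Local Notation C := R[i].
Local Notation qc := (@quaternion_of_complex R).

Definition quatj : quaternion R := Quaternion 0 1.

(* The sign makes [twist a b] and [twist (conj a)^-1 (~~ b)] mutually inverse
   although [quatj * quatj = -1]. *)
Definition twist (a : C) (b : bool) : quaternion R :=
  if a^*%C == a then 1 else if b then quatj else - quatj.

Lemma quatjM : quatj * quatj = -1.
Proof.
apply: quat_eq; first by rewrite -[LHS]/(0 * 0 - 1 * 1^*%C) conjc1 mul0r mulr1 sub0r.
by rewrite -[LHS]/(0 * 1 + 1 * 0^*%C) conjc0 mul0r mulr0 -[RHS]/(- 0) oppr0 addr0.
Qed.

Lemma quatjC (z : C) : quatj * qc z = qc z^*%C * quatj.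
Proof.
apply: quat_eq.
  rewrite -[LHS]/(0 * z - 1 * 0^*%C) -[RHS]/(z^*%C * 0 - 0 * 1^*%C).
  by rewrite conjc0 !mul0r !mulr0.
rewrite -[LHS]/(0 * 0 + 1 * z^*%C) -[RHS]/(z^*%C * 1 + 0 * 0^*%C).
by rewrite !mul0r mul1r mulr1 add0r addr0.
Qed.

Lemma twistM (a : C) (b : bool) : twist a b * twist (a^*%C)^-1 (~~ b) = 1.
Proof.
rewrite /twist conjc_inv conjcK (inj_eq invr_inj) eq_sym.
by case: eqP => _; rewrite ?mulr1 //; case: b; rewrite /= ?mulrN ?mulNr quatjM opprK.
Qed.

Lemma twist_mxK (a : C) (b : bool) (p q : nat) (M : 'M[quaternion R]_(p, q)) :
  M *m (twist a b)%:M *m (twist (a^*%C)^-1 (~~ b))%:M = M.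
Proof. by rewrite -mulmxA -scalar_mxM twistM mulmx1. Qed.

(** Moving j past a complex number conjugates it; for real a the twist is 1 and the hypothesis makes
    conjugation harmless. *)
Lemma twist_mx (a : C) (b : bool) (p : nat) (M : 'M[C]_p) :
  (a^*%C = a -> map_mx conjc M = M) ->
  (twist a b)%:M *m map_mx qc M = map_mx qc (map_mx conjc M) *m (twist a b)%:M.
Proof.
rewrite /twist; case: eqP => [ar /(_ ar) ->|_ _]; first by rewrite mul1mx mulmx1.
apply/matrixP => i j; rewrite mul_scalar_mx !mxE (bigD1 j) //= big1 => [|l lj].
  by rewrite !mxE eqxx /= addr0; case: b; rewrite ?mulNr ?mulrN quatjC.
by rewrite !mxE (negPf lj) mulr0.
Qed.

Definition flip_block (a : C) (b : bool) (p : nat) : 'M[quaternion R]_p :=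
  map_mx qc (flipmx C a^-1 p) *m (twist a b)%:M.

(** Moving the twist to the right turns J(conj(a)^-1, p) into J(a^-1, p), and [jordan_flip] at a^-1
    applies. *)
Lemma jordan_flip_block (a : C) (b : bool) (p : nat) : a != 0 ->
  jordan_block a p *m flip_block a b p *m jordan_block (a^*%C)^-1 p = flip_block a b p.
Proof.
move=> a0; rewrite !jordan_blockE /flip_block -!mulmxA twist_mx; last first.
  by move=> ar; rewrite map_jordan /= conjc_inv conjcK ar.
rewrite map_jordan /= conjc_inv conjcK !mulmxA -!map_mxM.
by rewrite -[X in jordan C X p *m _](invrK a) jordan_flip ?invr_eq0.
Qed.

(** Moving the first twist past the second flip matrix conjugates the latter's parameter from
    conj(a) to a; the flips then cancel, and so do the twists. *)
Lemma flip_blockM (a : C) (b : bool) (p : nat) : a != 0 ->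
  flip_block a b p *m flip_block (a^*%C)^-1 (~~ b) p = 1%:M.
Proof.
move=> a0; rewrite /flip_block invrK mulmxA -(mulmxA _ _%:M) twist_mx; last first.
  by move=> ar; rewrite map_flipmx /= conjcK ar.
rewrite map_flipmx /= conjcK mulmxA twist_mxK -map_mxM.
by rewrite flipmxV // map_mx1.
Qed.

(** Matched blocks have sizes that are equal but not convertible, so [conform_mx] carries the square
    block to a nominally rectangular one. *)
Lemma jordan_flip_conform (a : C) (b : bool) (p q : nat) : a != 0 -> p = q ->
  jordan_block a p *m conform_mx (0 : 'M_(p, q)) (flip_block a b p)
    *m jordan_block (a^*%C)^-1 q
  = conform_mx (0 : 'M_(p, q)) (flip_block a b p).
Proof. by move=> a0 <-; rewrite conform_mx_id jordan_flip_block. Qed.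

Lemma flip_conformM (a : C) (b : bool) (p q : nat) : a != 0 -> p = q ->
  conform_mx (0 : 'M_(p, q)) (flip_block a b p)
    *m conform_mx (0 : 'M_(q, p)) (flip_block (a^*%C)^-1 (~~ b) q) = 1%:M.
Proof. by move=> a0 <-; rewrite !conform_mx_id flip_blockM. Qed.

Lemma mxdiag_jordan_reverser (k : nat) (lam : 'I_k -> C) (m : 'I_k -> nat) (p : 'I_k -> 'I_k) :
  involutive p -> (forall i, lam i != 0) ->
  (forall i, lam (p i) = ((lam i)^*%C)^-1) -> (forall i, m (p i) = m i) ->
  (forall i, p i = i -> (lam i)^*%C = lam i) ->
  let D := \mxdiag_i jordan_block (lam i) (m i) in
  exists h, h *m h = 1%:M /\ D *m h *m D = h.
Proof.
move=> pp lam0 lamp mp fixp D.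
(* The boolean [i < p i] takes opposite values at the two members of a pair. *)
pose X i := flip_block (lam i) (i < p i)%N (m i).
pose B i j : 'M[quaternion R]_(m i, m j) := if j == p i then conform_mx 0 (X i) else 0.
(* At a fixed point of p the boolean is not negated, but the eigenvalue is real there and the twist
   ignores it. *)
have XE i : X (p i) = flip_block ((lam i)^*%C)^-1 (~~ (i < p i)%N) (m (p i)).
  rewrite /X lamp pp; have [pi|] := eqVneq (p i) i.
    by rewrite /flip_block /twist conjc_inv conjcK (inj_eq invr_inj) (fixp _ pi) eqxx.
  by rewrite -leqNgt [(p i <= i)%N]leq_eqVlt -val_eqE => /negPf->.
exists (\mxblock_(i, j) B i j); split.
  rewrite mul_mxblock -[RHS]mxdiagZ /mxdiag; apply/eq_mxblock => i l.
  rewrite (bigD1 (p i)) //= big1 => [|j /negPf jp]; last by rewrite /B jp mul0mx.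
  rewrite addr0 /B eqxx pp eq_sym; case: eqVneq => [<-|_]; last by rewrite mulmx0.
  by rewrite XE conform_mx_id flip_conformM.
rewrite mul_mxdiag_mxblock mul_mxblock_mxdiag; apply/eq_mxblock => i j.
rewrite /B; case: eqVneq => [->|_]; last by rewrite mulmx0 mul0mx.
by rewrite lamp jordan_flip_conform.
Qed.

End Involution.

(** * Reversers *)

Lemma intertwine_exp (K : pzSemiRingType) (n : nat) (P X Y : 'M[K]_n) (k : nat) :
  P *m X = Y *m P -> P *m X ^+ k = Y ^+ k *m P.
Proof.
move=> PX; elim: k => [|k IH]; first by rewrite !expr0 mulmx1 mul1mx.
by rewrite !exprS -!mulmxE mulmxA PX -!mulmxA IH.
Qed.

(** X^-1 - a = (X - a^-1) (-a X^-1), with commuting factors. *)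
Lemma invmx_sub_exp (F : fieldType) (n : nat) (X : 'M[F]_n) (a : F) (k : nat) :
  X \in unitmx -> a != 0 ->
  (invmx X - a%:M) ^+ k = (X - (a^-1)%:M) ^+ k *m (- a *: invmx X) ^+ k.
Proof.
move=> uX a0.
have cXV : GRing.comm (X - (a^-1)%:M) (- a *: invmx X).
  rewrite /GRing.comm -!mulmxE -scalemxAl -scalemxAr mulmxBr mulmxBl mulVmx //.
  by rewrite mulmxV // scalar_mxC.
rewrite mulmxE -(exprMn_comm _ cXV) -mulmxE; congr (_ ^+ k).
rewrite -scalemxAr mulmxBl mulmxV // mul_scalar_mx.
by rewrite scaleNr scalerBr scalerA mulfV // scale1r opprB scalemx1.
Qed.

Lemma rank_invmx_exp (F : fieldType) (n : nat) (X : 'M[F]_n) (a : F) (k : nat) :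
  X \in unitmx -> a != 0 ->
  \rank ((invmx X - a%:M) ^+ k) = \rank ((X - (a^-1)%:M) ^+ k).
Proof.
move=> uX a0; rewrite invmx_sub_exp // mxrankMfree // row_free_unit.
by apply: expmx_unit; rewrite unitmxZ ?unitmx_inv // unitfE oppr_eq0.
Qed.

Lemma mulmx_sub_invmx (F : fieldType) (n : nat) (U P X : 'M[F]_n) (a : F) :
  U \in unitmx -> U *m P *m X = P -> P *m (X - a%:M) = (invmx U - a%:M) *m P.
Proof.
move=> uU UPX; rewrite mulmxBr mulmxBl scalar_mxC; congr (_ - _).
by rewrite -{2}UPX -mulmxA mulKmx.
Qed.

Section Reverse.
Variable R : rcfType.
Local Notation C := R[i].

Lemma Im_conjcV (a : C) :
  complex.Im (a^*%C)^-1 = complex.Im a / (complex.Re a ^+ 2 + complex.Im a ^+ 2).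
Proof. by case: a => x y /=; rewrite sqrrN mulNr opprK. Qed.

(** For nonzero a, conj(a)^-1 = a / |a|^2 is a positive multiple of a, so matching eigenvalues
    respects the half-planes. *)
Lemma Im_conjcV_lt0 (a : C) : (complex.Im (a^*%C)^-1 < 0) = (complex.Im a < 0).
Proof.
rewrite Im_conjcV; have [->|a0] := eqVneq (complex.Im a) 0; first by rewrite mul0r.
by rewrite pmulr_llt0 // invr_gt0 ltr_wpDl ?sqr_ge0 // exprn_even_gt0.
Qed.

Lemma Im_conjc (a : C) : complex.Im a^*%C = - complex.Im a.
Proof. by case: a. Qed.

Lemma conjc_id (a : C) : (a^*%C == a) = (complex.Im a == 0).
Proof. by case: a => x y; rewrite eq_complex /= eqxx /= eqNr. Qed.

Section Matrix.
Variables (n : nat) (A : 'M[quaternion R]_n).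

Lemma even_rank_reverser (h : 'M[quaternion R]_n) (a : C) (k : nat) :
  qdet A = 1 -> h *m h = 1%:M -> A *m h *m A = h -> a * a^*%C = 1 ->
  ~~ odd (\rank ((mxcomplex A - a%:M) ^+ k)).
Proof.
move=> detA hh AhA aa.
set X := mxcomplex A; set H := mxcomplex h; set U := map_mx conjc X.
have HH : H *m H = 1%:M by rewrite -mxcomplexM hh mxcomplex1.
have uU : U \in unitmx by rewrite map_unitmx unitmxE -/(qdet A) detA unitr1.
(* On row vectors, v |-> conj(v) P is the quaternionic structure composed with the involution. *)
pose P := mxJ R n *m H.
have PP : map_mx conjc P *m P = - 1%:M.
  rewrite map_mxM map_mxJ -mxcomplex_comm -mulmxA (mulmxA (mxJ R n)) mxJ_sqr.
  by rewrite mulNmx mul1mx mulmxN HH.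
have UPX : U *m P *m X = P.
  have UJ : U *m mxJ R n = mxJ R n *m X.
    by rewrite -{1}map_mxJ -map_mxM mxcomplex_comm map_mxM map_mxJ map_conjcK.
  by rewrite /P !mulmxA UJ -!mulmxA (mulmxA X) -!mxcomplexM AhA.
have PX : P *m (X - a%:M) = (invmx U - a%:M) *m P.
  by apply: mulmx_sub_invmx.
have a0 : a != 0 by apply: contra_eq_neq aa => ->; rewrite mul0r eq_sym oner_eq0.
have aV : a^-1 = a^*%C by rewrite -[LHS]mulr1 -aa mulKf.
have := even_rank_antilinear R _ _ P (kermx ((X - a%:M) ^+ k)) PP.
(* The total dimension n + n is even, so kernel and rank have the same parity. *)
rewrite mxrank_ker oddB ?rank_leq_row // oddD addbb; apply.
(* Stability of the kernel K: (U^-1 - a)^k has the left factor (U - conj(a))^k = conj((X - a)^k),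
   which annihilates conj(K). *)
rewrite sub_kermx -mulmxA (intertwine_exp _ _ _ _ _ _ PX) invmx_sub_exp // aV.
have -> : U - (a^*%C)%:M = map_mx conjc (X - a%:M) by rewrite map_mxB map_scalar_mx.
have -> : map_mx conjc (X - a%:M) ^+ k = map_mx conjc ((X - a%:M) ^+ k).
  by rewrite rmorphXn.
by rewrite !mulmxA -map_mxM mulmx_ker map_mx0 !mul0mx.
Qed.

Variables (k : nat) (lam : 'I_k -> C) (m : 'I_k -> nat).
Hypothesis hJ : jordan_decomposition A lam m.

Local Notation count := (count_blocks R k lam m).

Lemma count_jordan_lt0 (a : C) (t : nat) : complex.Im a < 0 -> count a t = 0%N.
Proof.
move=> a0; apply/eqP; rewrite cards_eq0; apply/eqP/setP => i; rewrite !inE.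
case: eqP => // e; have [lam0 _ _] := hJ.
by move: (lam0 i); rewrite e leNgt a0.
Qed.

(** The complex matrix of A is invertible, so the ranks of its powers are constant and their second
    differences vanish; a block with eigenvalue 0 would make one positive. *)
Lemma jordan_decomposition_neq0 : qdet A = 1 -> forall i, lam i != 0.
Proof.
move=> detA i; apply/eqP => lam0; have [_ m0 _] := hJ.
have r l : \rank ((mxcomplex A - (0 : C)%:M) ^+ l) = (n + n)%N.
  by rewrite raddf0 subr0; apply/mxrank_unit/expmx_unit; rewrite unitmxE -/(qdet A) detA unitr1.
have := rank_diff2_jordan _ _ _ _ _ _ 0 (m i).-1 hJ; rewrite !r -addnn.
rewrite (prednK (m0 i)) {1}/count_blocks (cardsD1 i) inE lam0 !eqxx /=; lia.
Qed.

Lemma count_jordan_reversible (h h' : 'M[quaternion R]_n) (a : C) (t : nat) :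
  qdet A = 1 -> h *m h' = 1%:M -> h *m A *m h' = mxinvq A ->
  count (a^*%C)^-1 t = count a t.
Proof.
move=> detA hh' hAh; have [_ m0 _] := hJ.
(* With the convention 0^-1 = 0 this case is trivial. *)
have [->|a0] := eqVneq a 0; first by rewrite conjc0 invr0.
case: t => [|t].
  by rewrite /count_blocks !(eq_card0 (A := [set _ | _])) // => i;
    rewrite !inE -[m i == _]negbK -lt0n m0 andbF.
have HH' : mxcomplex h *m mxcomplex h' = 1%:M by rewrite -mxcomplexM hh' mxcomplex1.
have uX : mxcomplex A \in unitmx by rewrite unitmxE -/(qdet A) detA unitr1.
have rV l : \rank ((mxcomplex A - a%:M) ^+ l) = \rank ((mxcomplex A - (a^-1)%:M) ^+ l).
  transitivity (\rank ((invmx (mxcomplex A) - a%:M) ^+ l)); last exact: rank_invmx_exp.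
  rewrite -(mxcomplexV detA) -hAh !mxcomplexM.
  exact: esym (rank_conj_expmx _ _ _ _ _ _ _ HH').
have := count_blocks_eq _ _ _ _ _ _ _ _ t hJ rV; rewrite conjc_inv.
(* The ranks only equate the sums of counts over {a, conj(a)} and {a^-1, conj(a)^-1}. Off the real
   line one term of each sum lies in the lower half-plane and vanishes; on it each count is
   doubled. *)
have [an|an|a_real] := ltrgt0P (complex.Im a).
- have -> : count a^*%C t.+1 = 0%N by rewrite count_jordan_lt0 // Im_conjc oppr_lt0.
  have -> : count a^-1 t.+1 = 0%N.
    by rewrite -[a]conjcK count_jordan_lt0 // Im_conjcV_lt0 Im_conjc oppr_lt0.
  by lia.
- by rewrite [count a t.+1]count_jordan_lt0 // [count (a^*%C)^-1 _]count_jordan_lt0 //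
    Im_conjcV_lt0.
- have /eqP -> : a^*%C == a by rewrite conjc_id a_real.
  by lia.
Qed.

Lemma jordan_decomposition_reverser (p : 'I_k -> 'I_k) :
  qdet A = 1 -> involutive p ->
  (forall i, lam (p i) = ((lam i)^*%C)^-1) -> (forall i, m (p i) = m i) ->
  (forall i, p i = i -> (lam i)^*%C = lam i) ->
  exists h, h *m h = 1%:M /\ A *m h *m A = h.
Proof.
move=> detA pp lamp mp fixp.
have [h [hh DhD]] := mxdiag_jordan_reverser R k lam m p pp
  (jordan_decomposition_neq0 detA) lamp mp fixp.
have [_ _ [e [S [T [ST TS SAT]]]]] := hJ.
pose g : 'M_n := castmx (e, e) h.
have [gg DgD] : g *m g = 1%:M /\ S *m A *m T *m g *m (S *m A *m T) = g.
  (* Once the size equality is eliminated, the casts are identities. *)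
  by rewrite SAT /g; case: n / e {SAT g}; rewrite !castmx_id.
exists (T *m g *m S); split.
  by rewrite !mulmxA -(mulmxA _ S T) ST mulmx1 -(mulmxA T) gg mulmx1 TS.
have AE : A = T *m (S *m A *m T) *m S by rewrite !mulmxA TS mul1mx -mulmxA TS mulmx1.
rewrite {1 2}AE -[in RHS]DgD !mulmxA.
by rewrite -(mulmxA _ S T) ST mulmx1 -(mulmxA _ S T) ST mulmx1.
Qed.

End Matrix.
End Reverse.

(** * From group elements to matrices, and the equivalence *)

Section Group.
Variables (R : rcfType) (n : nat).

(** A h A = h rewrites h A h^-1 = A^-1 without inverses. Conversely, a matrix involution has
    determinant 1 by [qdet_involution], so it automatically lies in SL(n, H). *)
Lemma strongly_reversibleP (A : SLH R n) :
  strongly_reversible A <->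
  exists h, h *m h = 1%:M /\ slmx A *m h *m slmx A = h.
Proof.
split=> [[h [hh hAh]]|[h [hh AhA]]].
  exists (slmx h); split; first exact: (congr1 (@slmx R n) hh).
  have : (A * h * A = h)%g.
    have e : (h * A = A^-1 * h)%g by rewrite -hAh -mulgA mulVg mulg1.
    by rewrite -mulgA e mulgA mulgV mul1g.
  exact: (congr1 (@slmx R n)).
have detH : qdet h == 1 by rewrite qdet_involution.
pose H := MkSLH detH.
have HH : (H * H = 1)%g by apply: val_inj.
have AHA : (A * H * A = H)%g by apply: val_inj.
exists H; split; first by rewrite /involution expgS expg1.
by apply: (mulgI A); rewrite mulgV !mulgA AHA mulgV.
Qed.

Lemma reversible_mx (A : SLH R n) : reversible A ->
  exists h h', h *m h' = 1%:M /\ h *m slmx A *m h' = mxinvq (slmx A).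
Proof.
case=> h hAh; exists (slmx h), (slmx h^-1%g); split.
  exact: (congr1 (@slmx R n) (mulgV h)).
exact: (congr1 (@slmx R n) hAh).
Qed.

End Group.

Theorem theorem1p3 (R : realType) (n : nat) (hn : (1 <= n)%N) (A : SLH R n)
    (hA : reversible A)
    (k : nat) (lam : 'I_k -> R[i]) (m : 'I_k -> nat)
    (hJ : jordan_decomposition A lam m) :
  strongly_reversible A <->
  (forall (alpha : R[i]) (t : nat),
      0 < complex.Im alpha -> `|alpha| = 1 -> (1 <= t)%N ->
      ~~ odd #|[set i : 'I_k | (lam i == alpha) && (m i == t)]|).
Proof.
have detA := eqP (slmx_det A).
apply: (iff_trans (strongly_reversibleP _ _ A)); split.
  case=> h [hh AhA] a [//|t] a_gt0 norm_a _.
  have aa : a * a^*%C = 1 by rewrite -sqr_normc norm_a expr1n.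
  have ev l := even_rank_reverser _ _ _ _ a l detA hh AhA aa.
  (* Modulo 2 the ranks and the doubled term disappear; the count at conj(a) is 0 because conj(a)
     lies in the lower half-plane. *)
  have := congr1 odd (rank_diff2_jordan _ _ _ _ _ _ a t hJ).
  rewrite [count_blocks _ _ _ _ a^*%C _](count_jordan_lt0 _ _ _ _ _ _ hJ).
    by rewrite addn0 !oddD odd_double (negPf (ev t)) (negPf (ev t.+2)) /= => <-.
  by rewrite Im_conjc oppr_lt0.
move=> even_count.
have [h [h' [hh' hAh]]] := reversible_mx _ _ _ hA.
(* A type is an eigenvalue with a size. Real types may stay unmatched only when [kappa] fixes them,
   that is for eigenvalue 1 or -1, or the degenerate value 0. *)
pose f i := (lam i, m i); pose kappa (x : R[i] * nat) := ((x.1^*%C)^-1, x.2).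
pose fixable := [pred x : R[i] * nat | (x.1^*%C == x.1) && (kappa x == x)].
have fE x : #|[set i in [set: 'I_k] | f i == x]| = count_blocks R k lam m x.1 x.2.
  by case: x => b t; apply: eq_card => i; rewrite !inE.
have kappaK : involutive kappa.
  by case=> b t; rewrite /kappa /= conjc_inv conjcK invrK.
have [||| p hp] := pairing_involution _ _ f kappa fixable [set: 'I_k] kappaK.
- by move=> x /andP[_ /eqP].
- by move=> x; rewrite !fE (count_jordan_reversible _ _ _ _ _ _ hJ _ _ _ _ detA hh' hAh).
(* Such a b is non-real with b = conj(b)^-1, so |b| = 1 and the evenness hypothesis applies in the
   upper half-plane; in the lower one there are no blocks. *)
- case=> b t kx; rewrite negb_and kx eqxx orbF conjc_id fE /= => b_im.
  case: t kx => [|t] kx.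
    have [_ m0 _] := hJ; rewrite /count_blocks eq_card0 // => i.
    by rewrite !inE [m i == _]eqn0Ngt m0 andbF.
  move: b_im; rewrite neq_lt => /orP[b_lt0|b_gt0].
    by rewrite (count_jordan_lt0 _ _ _ _ _ _ hJ).
  apply: even_count => //; case: kx => kb.
  have b0 : b != 0 by apply: contraTneq b_gt0 => ->; rewrite ltxx.
  have : `|b| ^+ 2 == 1 by rewrite sqr_normc -{1}kb mulVf // conjc_eq0.
  by rewrite sqrp_eq1 // => /eqP.
have pP i : [/\ p (p i) = i, f (p i) = kappa (f i) & p i = i -> fixable (f i)].
  by have [] := hp i (in_setT i).
apply: (jordan_decomposition_reverser _ _ _ _ _ _ hJ p detA).
- by move=> i; have [] := pP i.
- by move=> i; have [_ []] := pP i.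
- by move=> i; have [_ []] := pP i.
- by move=> i pi; have [_ _ /(_ pi) /andP[/eqP]] := pP i.
Qed.
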